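(* Let $k\in\mathbb N$, let $S_k=\{x_1,\dots,x_k\}$ be a set of $k$ distinct elements of $G\setminus\{0\}$, and let $\mu_0,\mu_n\in\mathcal M$ $(n\in\mathbb N)$ with $\mathrm{w}^*\text{-}\lim\mu_n=\mu_0$. (i) Let $p\in(0,\infty)$. If $d_p(\mu_0;S_k)=0$ or $[\mathcal T(S_k)]_{\mu_0}$ is a $k$-dimensional subspace of $L^p(\mu_0)$, then $\lim_{n\to\infty}d_p(\mu_n;S_k)=d_p(\mu_0;S_k)$. (ii) Let $p\in(1,\infty)$ and $\mu_0\ll\mu_n$ for all $n\in\mathbb N$. If $[\mathcal T(S_k\cup\{0\})]_{\mu_0}$ is a $(k+1)$-dimensional subspace of $L^p(\mu_0)$, then $\lim_{n\to\infty}d_p(\mu_n,\mu_0;S_k)=d_p(\mu_0;S_k)$ and $\lim_{n\to\infty}\int|\phi_{\mu_0,p}(S_k)-\phi_{\mu_n,p}(S_k)|^p\,d\mu_0=0$.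
   Context: $G$ is a locally compact abelian Hausdorff group (written additively), $\Gamma$ is its dual group, and for $x\in G$, $e_x:\Gamma\to\mathbb C$ denotes the character of $\Gamma$ generated by $x$ ($e_0=1$). $\mathcal M$ is the set of all non-zero finite non-negative regular Borel measures on $\Gamma$. For a non-empty set $S\subseteq G$, $\mathcal T(S)$ is the complex linear space of all finite sums $\sum_j a_je_{x_j}$ with $a_j\in\mathbb C$, $x_j\in S$; for finite $S$, $[\mathcal T(S)]_\mu$ denotes the finite-dimensional space of $\mu$-equivalence classes of elements of $\mathcal T(S)$. For non-empty $S\subseteq G\setminus\{0\}$ and $p\in(0,\infty)$, $d_p(\mu;S):=\inf\{\int|1-\tau|^p\,d\mu:\tau\in\mathcal T(S)\}$. For $p\in(1,\infty)$, the metric projection $\phi_{\mu,p}(S)$ is the unique element of the closure of $\mathcal T(S)$ in $L^p(\mu)$ with $\int|1-\phi_{\mu,p}(S)|^p\,d\mu=d_p(\mu;S)$. If $\mu\ll\nu$, $d_p(\nu,\mu;S):=\int|1-\phi_{\nu,p}(S)|^p\,d\mu\in[0,\infty]$. $\mathrm{w}^*\text{-}\lim\mu_n=\mu_0$ means $\lim_{n}\int f\,d\mu_n=\int f\,d\mu_0$ for every bounded continuous $f:\Gamma\to\mathbb C$. *)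

(* Defs.v *)
From HB Require Import structures.
From mathcomp Require Import all_boot all_order all_algebra.
From mathcomp Require Import complex.
From mathcomp Require Import all_classical all_reals all_analysis.

Set Implicit Arguments.
Unset Strict Implicit.
Unset Printing Implicit Defensive.

Import Order.TTheory GRing.Theory Num.Theory.
Import numFieldNormedType.Exports.

Local Open Scope classical_set_scope.
Local Open Scope ring_scope.

(* The complex numbers over R; [^o] gives access to the topology (of the
   modulus) that the library puts on every numFieldType. *)
Notation Cplx R := (R[i]%type^o).

(* The modulus as an element of R (the generic norm `|z| lives in R[i]). *)
Notation cmod z := (Normc.normc z).

Section Dual.
Variables (R : realType) (G : topologicalZmodType).

Definition character : set {compact-open, G -> Cplx R} :=
  [set chi | [/\ continuous (chi : G -> Cplx R),
                 forall x, cmod (chi x) = 1 &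
                 forall x y, chi (x + y) = chi x * chi y]].

(* The dual group of G.  Only its underlying topological space (the topology of
   uniform convergence on compact sets) is needed below. *)
Definition dual : Type := set_type character.

HB.instance Definition _ := Topological.on dual.

Lemma character1 : (fun=> 1 : Cplx R) \in character.
Proof.
rewrite inE; split=> [x|x|x y]; [exact: cvg_cst| |by rewrite mulr1].
exact: Normc.normc1.
Qed.

HB.instance Definition _ :=
  isPointed.Build dual (exist _ (fun=> 1 : Cplx R) character1).

Definition dual_fun (gamma : dual) : G -> Cplx R := set_val gamma.

Definition echar (x : G) : dual -> Cplx R := fun gamma => dual_fun gamma x.

Definition trig_poly (S : set G) : set (dual -> Cplx R) :=
  [set tau | exists (n : nat) (a : 'I_n -> Cplx R) (x : 'I_n -> G),
     (forall j, S (x j)) /\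
     tau = fun gamma => \sum_(j < n) a j * echar (x j) gamma].

(* [dual] itself, equipped with its Borel sigma-algebra. *)
Definition borel_dual := g_sigma_algebraType [set U : set dual | open U].

Definition regular_measure (mu : set borel_dual -> \bar R) :=
  forall E : set borel_dual, measurable E ->
    mu E = ereal_inf [set mu U | U in [set U : set dual | open U /\ E `<=` U]]
    /\
    mu E = ereal_sup [set mu K | K in [set K : set dual | compact K /\ K `<=` E]].

Definition class_M : set {finite_measure set borel_dual -> \bar R} :=
  [set mu : {finite_measure set borel_dual -> \bar R} |
     mu [set: borel_dual] != 0%E /\ regular_measure mu].

Definition cintegral (mu : {measure set borel_dual -> \bar R})
    (f : dual -> Cplx R) : Cplx R :=
  Complex (\int[mu]_(gamma in [set: borel_dual]) complex.Re (f gamma))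
          (\int[mu]_(gamma in [set: borel_dual]) complex.Im (f gamma)).

Definition wstar_cvg (mu : nat -> {finite_measure set borel_dual -> \bar R})
    (mu0 : {finite_measure set borel_dual -> \bar R}) :=
  forall f : dual -> Cplx R, continuous f ->
    (exists M : R, forall gamma, cmod (f gamma) <= M) ->
    (fun n => cintegral (mu n) f) @ \oo --> cintegral mu0 f.

Section Lp.
Variables (mu : {measure set borel_dual -> \bar R}) (p : R).

(* The integral of |f - g|^p, which makes sense for all 0 < p. *)
Definition Lp_dist (f g : dual -> Cplx R) : \bar R :=
  (\int[mu]_(gamma in [set: borel_dual])
     ((cmod (f gamma - g gamma) `^ p)%:E))%E.

(* Elements of L^p are handled through representatives, and equality of
   classes is equality mu-almost everywhere. *)
Definition Lp_space : set (dual -> Cplx R) :=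
  [set f : dual -> Cplx R |
    [/\ measurable_fun [set: borel_dual] (fun gamma => complex.Re (f gamma)),
        measurable_fun [set: borel_dual] (fun gamma => complex.Im (f gamma)) &
        (Lp_dist f (fun=> 0%R) < +oo)%E]].

Definition Lp_closure (V : set (dual -> Cplx R)) : set (dual -> Cplx R) :=
  [set f | Lp_space f /\
     forall eps : R, 0 < eps ->
       exists2 tau, V tau & (Lp_dist f tau < eps%:E)%E].

(* The mu-equivalence classes of the elements of V form an n-dimensional
   subspace of L^p(mu): the classes of b_0, ..., b_(n-1) are a basis. *)
Definition Lp_subspace_of_dim (V : set (dual -> Cplx R)) (n : nat) :=
  V `<=` Lp_space /\
  exists b : 'I_n -> dual -> Cplx R,
    [/\ forall i, V (b i),
        forall a : 'I_n -> Cplx R,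
          {ae mu, forall gamma : borel_dual, \sum_(i < n) a i * b i gamma = 0} ->
          forall i, a i = 0 &
        forall f, V f -> exists a : 'I_n -> Cplx R,
          {ae mu, forall gamma : borel_dual,
            f gamma = \sum_(i < n) a i * b i gamma}].

Variable S : set G.

Definition d_p : \bar R :=
  ereal_inf [set Lp_dist (fun=> 1) tau | tau in trig_poly S].

Definition is_metric_projection (phi : dual -> Cplx R) :=
  Lp_closure (trig_poly S) phi /\ Lp_dist (fun=> 1) phi = d_p.

(* For 1 < p the element of L^p(mu) described by [is_metric_projection] exists
   and is unique, so this is a representative of that element. *)
Definition metric_projection : dual -> Cplx R :=
  xget (fun=> 0) [set phi | is_metric_projection phi].

End Lp.

Definition d_p2 (nu mu : {measure set borel_dual -> \bar R}) (p : R)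
    (S : set G) : \bar R :=
  Lp_dist mu p (fun=> 1) (metric_projection nu p S).

End Dual.

(* Main.v *)
Require Import Defs.
From mathcomp Require Import all_boot all_order all_algebra.
From mathcomp Require Import complex.
From mathcomp Require Import all_classical all_reals all_analysis.
From mathcomp Require Import measurable_realfun ring lra.

Set Implicit Arguments.
Unset Strict Implicit.
Unset Printing Implicit Defensive.

Import Order.TTheory GRing.Theory Num.Theory.
Import numFieldNormedType.Exports.

Local Open Scope classical_set_scope.
Local Open Scope ring_scope.

(** Write [T a] for the trigonometric polynomial with coefficient vector [a] and
frequencies [x], and [err mu c a] for the integral of [|c - T a|^p] against
[mu].  Then [d_p mu p (range x)] is the infimum of [err mu 1] over a finite
dimensional space, so everything is a question about how the functions
[err (mu n) c] of finitely many complex variables converge.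

Two facts carry the proof.  First, [err (mu n) c b] is jointly close to
[err mu0 c a] when [b] is close to [a] and [n] is large ([err_near]): for fixed
coefficients the integrand is a bounded continuous function on the dual group,
so weak* convergence applies, and changing the coefficients moves the integrand
uniformly little because [t |-> t^p] is uniformly continuous on bounded
intervals while the masses of the [mu n] stay bounded.  Second, if the
characters are linearly independent in [L^p(mu0)], then [err (mu n) 0 a] is
eventually at least [c * |a|^p] with one constant [c > 0] ([err_coercive]): it
is positive on the compact unit sphere for [mu0], joint closeness and
compactness make it uniformly positive there for large [n], and homogeneity
does the rest.

Consequently near-minimizers of [err (mu n) 1] stay in a fixed ball, on which
[err (mu n) 1 >= d_p(mu0) - e] for large [n], again by compactness; together
with the easy bound [limsup d_p(mu_n) <= d_p(mu0)] this gives the convergence of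
the least errors.  When [d_p(mu0) = 0] the easy bound suffices.

For [p > 1], independence passes from [mu0] to every measure that dominates it,
and the metric projection for such a measure is almost everywhere a
trigonometric polynomial whose coefficients minimize the error
([metric_projection_trig]): minimizers exist by coercivity and the span of the
characters is closed because it is finite dimensional.  Strict convexity of
[|z|^p] makes the minimizer for [mu0] unique, hence the minimizing coefficients
for [mu n], being bounded, converge to those for [mu0] ([minimizers_cvg]), and
both limits of the second part are the continuity of [err mu0] in the
coefficients.

All compactness arguments use the formulation of compactness by which a
property that holds near each point of a compact set, eventually along a
filter, eventually holds on the whole set. *)

(** * The topology of the complex numbers in terms of the real modulus *)

Section ComplexModulus.
Variable R : realType.
Implicit Types z w : Cplx R.

Lemma normr_cmod z : `|z : R[i]| = Complex (cmod z) 0.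
Proof. by case: z => a b; rewrite normc_def. Qed.

Lemma cmod_ge0 z : 0 <= cmod z.
Proof. by case: z => a b; exact: sqrtr_ge0. Qed.

Lemma cmod_le_ReIm z : cmod z <= `|complex.Re z| + `|complex.Im z|.
Proof.
case: z => a b /=.
have := le_normcD (Complex a 0) (Complex 0 b).
by rewrite /= addr0 add0r expr0n /= addr0 add0r !sqrtr_sqr.
Qed.

Lemma Re_le_cmod z : `|complex.Re z| <= cmod z.
Proof.
by case: z => a b /=; rewrite -sqrtr_sqr ler_wsqrtr// lerDl sqr_ge0.
Qed.

Lemma Im_le_cmod z : `|complex.Im z| <= cmod z.
Proof.
by case: z => a b /=; rewrite -sqrtr_sqr ler_wsqrtr// lerDr sqr_ge0.
Qed.

Lemma cmod_dist z w : `|cmod z - cmod w| <= cmod (z - w).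
Proof.
rewrite ler_norml lerBlDr lerNl opprB lerBlDr; apply/andP; split.
  by rewrite -(normcN (z - w)) opprB -{1}(subrK z w) le_normcD.
by rewrite -{1}(subrK w z) le_normcD.
Qed.

Lemma cmod_sum (I : finType) (f : I -> Cplx R) :
  cmod (\sum_i f i) <= \sum_i cmod (f i).
Proof.
elim/big_ind2 : _ => [|u a v b ua vb|//]; first by rewrite Normc.normc0.
by rewrite (le_trans (le_normcD _ _))// lerD.
Qed.

Lemma cmod_real (t : R) : 0 <= t -> cmod (Complex t 0) = t.
Proof. by move=> t0; rewrite /= expr0n addr0 sqrtr_sqr ger0_norm. Qed.

Lemma cmod_double (z : Cplx R) : cmod (z + z) = 2 * cmod z.
Proof. by rewrite mulr_natl -normcMn. Qed.

Lemma midpoint_sub (F : numFieldType) (c a b : F) :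
  c - 2^-1 * (a + b) = 2^-1 * ((c - a) + (c - b)).
Proof. by field. Qed.

Lemma cmod_half : cmod (2^-1 : Cplx R) = 2^-1.
Proof. by rewrite Normc.normcV normcMn Normc.normc1. Qed.

Lemma cmod_midpoint_sub (c u v : Cplx R) :
  cmod (c - 2^-1 * (u + v)) = 2^-1 * cmod ((c - u) + (c - v)).
Proof. by rewrite (@midpoint_sub R[i]) Normc.normcM cmod_half. Qed.

(** The norm of [R[i]] takes its values in [R[i]] itself; this restates
convergence with real radii and the real modulus. *)
Lemma cplx_cvgP (T : Type) (F : set_system T) {FF : Filter F}
    (f : T -> Cplx R) (l : Cplx R) :
  f @ F --> l <->
  (forall eps : R, 0 < eps -> \forall t \near F, cmod (l - f t) < eps).
Proof.
split=> [/cvgrPdist_lt fl eps eps0|fl].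
  have /fl : 0 < (Complex eps 0 : R[i]) by rewrite ltcR.
  by apply: filterS => t; rewrite normr_cmod ltcR.
apply/cvgrPdist_lt => -[e e']; rewrite ltcE /= => /andP[/eqP -> e0].
by apply: filterS (fl _ e0) => t; rewrite normr_cmod ltcR.
Qed.

Lemma near_cmod z (e : R) : 0 < e -> \forall w \near z, cmod (z - w) < e.
Proof. exact: (cplx_cvgP (F := nbhs z) id z).1. Qed.

Lemma continuous_Re : continuous (@complex.Re R : Cplx R -> R).
Proof.
move=> z; apply/(cvgrPdist_lt (F := nbhs z)) => e e0.
have := near_cmod z e0.
apply: filterS => w; apply: le_lt_trans.
by case: z w => [a b] [c d]; exact: (Re_le_cmod (Complex (a - c) (b - d))).
Qed.

Lemma continuous_Im : continuous (@complex.Im R : Cplx R -> R).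
Proof.
move=> z; apply/(cvgrPdist_lt (F := nbhs z)) => e e0.
have := near_cmod z e0.
apply: filterS => w; apply: le_lt_trans.
by case: z w => [a b] [c d]; exact: (Im_le_cmod (Complex (a - c) (b - d))).
Qed.

Lemma continuous_cmod : continuous (fun z : Cplx R => cmod z).
Proof.
move=> z; apply/(cvgrPdist_lt (F := nbhs z)) => e e0.
have := near_cmod z e0.
by apply: filterS => w; apply: le_lt_trans; exact: cmod_dist.
Qed.

Lemma cvg_Complex (T : Type) (F : set_system T) {FF : Filter F}
    (f g : T -> R) (a b : R) : f @ F --> a -> g @ F --> b ->
  (fun t => Complex (f t) (g t) : Cplx R) @ F --> (Complex a b : Cplx R).
Proof.
move=> /cvgrPdist_lt fa /cvgrPdist_lt gb; apply/cplx_cvgP => e e0.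
have e2 : 0 < e / 2 by rewrite divr_gt0.
near=> t; apply: le_lt_trans (cmod_le_ReIm _) _ => /=.
rewrite (splitr e) ltrD//; near: t; [exact: fa|exact: gb].
Unshelve. all: by end_near. Qed.

(** The disc is a closed subset of the image of the square [[-M, M]^2], so the
compactness of real segments is enough. *)
Lemma compact_disc (M : R) : compact [set z : Cplx R | cmod z <= M].
Proof.
pose I := `[-M, M]%classic.
have cI : compact (I `*` I) by apply: compact_setX; exact: segment_compact.
pose f (u : R * R) : Cplx R := Complex u.1 u.2.
have cf : {within I `*` I, continuous f}.
  apply: continuous_subspaceT => u; apply: cvg_Complex.
    exact: cvg_fst.
  exact: cvg_snd.
have cD := continuous_compact cf cI.
apply: (subclosed_compact _ cD).
  rewrite (_ : mkset _ = (fun z : Cplx R => cmod z) @^-1` [set t | t <= M])//.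
  by apply: closed_comp; [move=> z _; exact: continuous_cmod|exact: closed_le].
move=> [a b] /= zM; exists (a, b) => //=; split; rewrite /I /= in_itv /= -ler_norml.
  exact: le_trans (Re_le_cmod (Complex a b)) zM.
exact: le_trans (Im_le_cmod (Complex a b)) zM.
Qed.

Lemma compact_polydisc (n : nat) (M : R) :
  compact [set a : 'rV[Cplx R]_n | forall j, cmod (a ord0 j) <= M].
Proof.
exact (@rV_compact (Cplx R) n (fun=> [set z : Cplx R | cmod z <= M])
  (fun=> @compact_disc M)).
Qed.

End ComplexModulus.

(** * Evaluation of characters *)

Section Characters.
Variables (R : realType) (G : topologicalZmodType).
Implicit Types (x : G).

Lemma cmod_echar x (gamma : dual R G) : cmod (echar x gamma) = 1.
Proof.
by case: gamma => chi chiP; have [_ + _] := set_mem chiP; apply.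
Qed.

(** Evaluation at [x] is continuous for the compact-open topology since the
singleton of [x] is compact. *)
Lemma continuous_echar x : continuous (@echar R G x).
Proof.
move=> gamma.
have cval : (@set_val _ (@character R G)) @ gamma -->
    (set_val gamma : {compact-open, G -> Cplx R}).
  exact: initial_continuous.
move: cval => /compact_open_cvgP cval.
move=> A /=; rewrite nbhsE => -[V] [oV Vx] VA.
have := cval (fmap_filter _ (nbhs_filter gamma)) [set x] V (@compact_set1 _ _) oV.
have h : [set (set_val gamma : G -> Cplx R) y | y in [set x]] `<=` V.
  by move=> _ [_ -> <-].
move=> /(_ h); apply: (@filterS _ _ (nbhs_filter gamma)) => delta /= dV.
by apply: VA; apply: dV; exists x.
Qed.

End Characters.

(** * Real powers *)

Section RealPowers.
Variables (R : realType) (p : R).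
Hypothesis p_gt0 : 0 < p.

(** The absolute value extends [t^p] continuously to negative [t], which makes
continuity at [0] a two-sided statement. *)
Lemma continuous_norm_powR : continuous (fun t : R => `|t| `^ p).
Proof.
move=> t; have [->|t0] := eqVneq t 0.
  rewrite /continuous_at normr0 powR0 ?gt_eqF//; apply/cvgrPdist_lt => e e0.
  have d0 : 0 < e `^ p^-1 by rewrite powR_gt0.
  near=> s; rewrite sub0r normrN ger0_norm ?powR_ge0//.
  have -> : e = (e `^ p^-1) `^ p by rewrite -powRrM mulVf ?gt_eqF// powRr1// ltW.
  apply: gt0_ltr_powR; rewrite // ?nnegrE// ?powR_ge0//.
apply: (@continuous_comp _ _ _ (fun s : R => `|s|) (fun s => s `^ p)).
  exact: norm_continuous.
apply/differentiable_continuous/derivable1_diffP.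
by apply: derivable_powR; rewrite in_itv/= andbT normr_gt0.
Unshelve. all: by end_near. Qed.

(** Uniform continuity of [t^p] on a segment, by compactness; it holds for every
[p > 0], where no Lipschitz bound is available when [p < 1]. *)
Lemma powR_uniform (L e : R) : 0 < e ->
  exists2 d, 0 < d & forall s t, 0 <= s <= L -> 0 <= t -> `|s - t| < d ->
    `|s `^ p - t `^ p| < e.
Proof.
move=> e0.
have /compact_near_coveringP/(_ _ (0^'+)) cvr := @segment_compact R 0 L.
pose P (d s : R) := forall t : R, 0 <= t -> `|s - t| < d -> `|(`|s| `^ p) - t `^ p| < e.
have e2 : 0 < e / 2 by rewrite divr_gt0.
have {}cvr : \forall d \near 0^'+, `[0, L]%classic `<=` P d.
  apply: cvr => s _.
  have /cvgrPdist_lt/(_ _ e2)/nbhs_ballP[r /= r0 sr] := @continuous_norm_powR s.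
  have r2 : 0 < r / 2 by rewrite divr_gt0.
  exists (ball s (r / 2), [set d | d < r / 2]).
    split; first exact: nbhsx_ballx.
    by near=> d; near: d; exact: nbhs_right_lt.
  move=> [s' d] [/= ss' dr] t t0 s't.
  have h1 : `|(`|s| `^ p) - `|s'| `^ p| < e / 2.
    by apply: sr; apply: le_ball ss'; rewrite ler_pdivrMr// ler_peMr// ?ler1n// ltW.
  have h2 : `|(`|s| `^ p) - `|t| `^ p| < e / 2.
    apply: sr; rewrite /ball /= (splitr r) (le_lt_trans (ler_distD s' _ _))//.
    by rewrite ltrD// (lt_trans s't).
  rewrite (ger0_norm t0) in h2.
  rewrite (splitr e) (le_lt_trans (ler_distD (`|s| `^ p) _ _))//.
  by rewrite ltrD// distrC.
have [d [dP d0]] : exists d, (`[0, L]%classic `<=` P d) /\ 0 < d.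
  near (0 : R)^'+ => d; exists d; split; last exact: (near (nbhs_right_gt _) d).
  exact: (near cvr d).
exists d => // s t /andP[s0 sL] t0 st.
have := dP s; rewrite /P /= in_itv /= s0 sL => /(_ isT t t0 st).
by rewrite (ger0_norm s0).
Unshelve. all: by end_near. Qed.

(** A substitute for the triangle inequality that is valid for all [p > 0]: the
sum is at most twice the larger term. *)
Lemma powR_add_le (s t : R) : 0 <= s -> 0 <= t ->
  (s + t) `^ p <= 2 `^ p * (s `^ p + t `^ p).
Proof.
wlog st : s t / s <= t => [h s0 t0|s0 t0].
  have [st|/ltW ts] := leP s t; first exact: h.
  by rewrite addrC (addrC (s `^ p)) h.
apply: (@le_trans _ _ ((2 * t) `^ p)).
  apply: ge0_ler_powR; rewrite ?nnegrE ?addr_ge0 ?mulr_ge0//; first exact: ltW.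
  by rewrite mulr_natl mulr2n lerD.
by rewrite powRM// ler_wpM2l ?powR_ge0// lerDr powR_ge0.
Qed.

Lemma powR_le_root (s Q : R) : 0 <= s -> s `^ p <= Q -> s <= Q `^ p^-1.
Proof.
move=> s0 sQ; have -> : s = (s `^ p) `^ p^-1.
  by rewrite -powRrM mulfV ?gt_eqF// powRr1.
apply: ge0_ler_powR; rewrite ?nnegrE ?powR_ge0 ?invr_ge0 ?(ltW p_gt0)//.
by rewrite (le_trans _ sQ)// powR_ge0.
Qed.

End RealPowers.

(** * Strict convexity of the power of the modulus *)

Section StrictConvexity.
Variables (R : realType) (p : R).
Hypothesis p_gt1 : 1 < p.

(** Bernoulli's inequality in its strict form.  If [L = 1 + p (y - 1)] is
positive, then [p y = (p - 1) + L], and adding [1 + ln z <= z] for [z = L / y] to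
[p - 1] times the same inequality for [z = 1 / y], where it is strict, gives
[ln L < p ln y]. *)
Lemma bernoulli_powR (y : R) : 0 <= y -> y != 1 -> 1 + p * (y - 1) < y `^ p.
Proof.
have p1 := p_gt1; move=> y0 y1; have p0 : 0 < p by lra.
have [L0|L0] := leP (1 + p * (y - 1)) 0.
  have [->|yn0] := eqVneq y 0; first by rewrite powR0 ?gt_eqF//; lra.
  by apply: le_lt_trans L0 _; rewrite powR_gt0// lt0r yn0.
have {}y0 : 0 < y.
  rewrite lt0r y0 andbT; apply/eqP => y0'; move: L0; rewrite y0'; lra.
set L := 1 + _ in L0 *.
have yV : y^-1 != 1 by rewrite invr_eq1.
have ln1 : 1 + ln y^-1 < y^-1.
  rewrite -[ltRHS]lnK ?posrE ?invr_gt0// expR_gt1Dx// ln_eq0 ?invr_gt0//.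
have ln2 : 1 + ln (L / y) <= L / y.
  by rewrite -[leRHS]lnK ?posrE ?divr_gt0// expR_ge1Dx.
rewrite lnM ?posrE ?invr_gt0// lnV ?posrE// in ln2.
rewrite lnV ?posrE// in ln1.
rewrite -ltr_ln ?posrE ?powR_gt0// ln_powR.
have yL : (p - 1) * y^-1 + L / y = p.
  have pL : p - 1 + L = p * y by rewrite /L; lra.
  by rewrite -mulrDl pL mulfK ?gt_eqF.
have : (p - 1) * (1 - ln y) < (p - 1) * y^-1 by rewrite ltr_pM2l//; lra.
lra.
Qed.

(** Bernoulli's inequality at [s / m] and [t / m], where [m] is the midpoint,
summed: the linear terms cancel. *)
Lemma midpoint_powR_lt (s t : R) : 0 <= s -> 0 <= t -> s != t ->
  ((s + t) / 2) `^ p < (s `^ p + t `^ p) / 2.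
Proof.
move=> s0 t0 st; set m := (s + t) / 2.
have m0 : 0 < m.
  rewrite /m divr_gt0// lt0r addr_ge0// andbT paddr_eq0//.
  by apply: contra st => /andP[/eqP -> /eqP ->].
have mn0 : m != 0 by rewrite gt_eqF.
have sm : s / m != 1.
  rewrite -(inj_eq (mulIf mn0)) divfK// mul1r; apply: contra st => /eqP sm.
  by apply/eqP; move: sm; rewrite /m; lra.
have tm : t / m != 1.
  rewrite -(inj_eq (mulIf mn0)) divfK// mul1r; apply: contra st => /eqP tm.
  by apply/eqP; move: tm; rewrite /m; lra.
have hs := bernoulli_powR (divr_ge0 s0 (ltW m0)) sm.
have ht := bernoulli_powR (divr_ge0 t0 (ltW m0)) tm.
have e (z : R) : 0 <= z -> z `^ p = m `^ p * (z / m) `^ p.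
  move=> z0; rewrite -powRM; [|exact: ltW|by rewrite divr_ge0// ltW].
  by rewrite mulrC divfK.
have stm : s / m + t / m = 2.
  rewrite -mulrDl /m invf_div mulrCA mulfV ?mulr1// gt_eqF//.
  by move: m0; rewrite /m; lra.
rewrite (e s)// (e t)// -mulrDr -mulrA -[ltLHS]mulr1 ltr_pM2l ?powR_gt0//.
have -> : t / m = 2 - s / m by lra.
move: ht; have -> : t / m = 2 - s / m by lra.
lra.
Qed.

(** Strictness comes from the power when the moduli differ, and from the
parallelogram identity when they agree. *)
Lemma cmod_midpoint_powR_lt (u v : Cplx R) : u != v ->
  (2^-1 * cmod (u + v)) `^ p < (cmod u `^ p + cmod v `^ p) / 2.
Proof.
have p1 := p_gt1; have p0 : 0 < p by lra.
move=> uv; have [uv'|uv'] := eqVneq (cmod u) (cmod v); last first.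
  apply: le_lt_trans (midpoint_powR_lt (cmod_ge0 u) (cmod_ge0 v) uv').
  apply: ge0_ler_powR; rewrite ?nnegrE ?(ltW p0)//.
  - by rewrite mulr_ge0 ?cmod_ge0.
  - by rewrite divr_ge0 ?addr_ge0 ?cmod_ge0.
  - by rewrite mulrC ler_pM2r// le_normcD.
have -> : (cmod u `^ p + cmod v `^ p) / 2 = cmod u `^ p by rewrite -uv'; lra.
apply: gt0_ltr_powR; rewrite ?nnegrE ?cmod_ge0//.
  by rewrite mulr_ge0 ?cmod_ge0.
have cE (z : Cplx R) : cmod z ^+ 2 = complex.Re z ^+ 2 + complex.Im z ^+ 2.
  by case: z => a b /=; rewrite sqr_sqrtr// addr_ge0 ?sqr_ge0.
have par : cmod (u + v) ^+ 2 + cmod (u - v) ^+ 2 = 2 * (cmod u ^+ 2 + cmod v ^+ 2).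
  by rewrite !cE; case: u v {uv uv'} => [a b] [c d] /=; lra.
have : 0 < cmod (u - v).
  rewrite lt0r cmod_ge0 andbT; apply: contra uv => /eqP/Normc.eq0_normc/eqP.
  by rewrite subr_eq0.
move=> /(exprn_gt0 2) uv2.
rewrite -(@ltr_pXn2r _ 2) ?nnegrE ?mulr_ge0 ?cmod_ge0// exprMn.
by move: par uv2; rewrite -uv'; lra.
Qed.

End StrictConvexity.

(** * Trigonometric polynomials with given frequencies *)

Section Trig.
Variables (R : realType) (G : topologicalZmodType) (k : nat) (x : 'I_k -> G).
Implicit Types (a b : 'rV[Cplx R]_k) (gamma : dual R G).

Definition trig a : dual R G -> Cplx R :=
  fun gamma => \sum_j a ord0 j * echar (x j) gamma.

(** A norm on coefficient vectors with values in [R]; the norm that matrices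
over [R[i]] carry takes its values in [R[i]]. *)
Definition coef_size a : R := \sum_j cmod (a ord0 j).

Lemma coef_size_ge0 a : 0 <= coef_size a.
Proof. by apply: sumr_ge0 => j _; exact: cmod_ge0. Qed.

Lemma coef_sizeZ (t : Cplx R) a : coef_size (t *: a) = cmod t * coef_size a.
Proof.
rewrite /coef_size mulr_sumr; apply: eq_bigr => j _.
by rewrite mxE Normc.normcM.
Qed.

Lemma coef_sizeD a b : coef_size (a + b) <= coef_size a + coef_size b.
Proof.
rewrite /coef_size -big_split; apply: ler_sum => j _.
by rewrite mxE le_normcD.
Qed.

Lemma near_coef_size a (d : R) : 0 < d -> \forall b \near a, coef_size (b - a) < d.
Proof.
move=> d0; have dk : 0 < d / k.+1%:R by rewrite divr_gt0.
have : \forall b \near a, forall j,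
    cmod (a ord0 j - (b : 'rV[Cplx R]_k) ord0 j) < d / k.+1%:R.
  apply: (@filter_forall _ _ _ _ (nbhs_filter a)) => j.
  exact: (@coord_continuous R[i] 1 k ord0 j a _ (near_cmod (a ord0 j) dk)).
apply: filterS => b ab.
apply: (@le_lt_trans _ _ (\sum_(j < k) d / k.+1%:R)).
  apply: ler_sum => j _; rewrite !mxE -normcN opprB; exact: ltW.
rewrite sumr_const card_ord -[_ *+ k]mulr_natr mulrAC -mulrA.
by rewrite gtr_pMr// ltr_pdivrMr// mul1r ltr_nat.
Qed.

Lemma compact_coef_size (M : R) : compact [set a | coef_size a <= M].
Proof.
apply: (subclosed_compact _ (@compact_polydisc R k M)).
  move=> a aM /=; apply/ler_addgt0Pr => e e0.
  have [b [/= bM ab]] := aM _ (near_coef_size a e0).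
  apply: le_trans (lerD bM (ltW ab)); rewrite /coef_size -big_split/=.
  apply: ler_sum => j _; rewrite !mxE -lerBlDl.
  rewrite (le_trans (ler_norm _))// (le_trans (cmod_dist _ _))//.
  by rewrite -normcN opprB.
move=> a /= + j; apply: le_trans; rewrite /coef_size (bigD1 j)//= lerDl.
by apply: sumr_ge0 => i _; exact: cmod_ge0.
Qed.

Lemma trigB a b gamma : trig (a - b) gamma = trig a gamma - trig b gamma.
Proof.
rewrite /trig -sumrB; apply: eq_bigr => j _.
by rewrite !mxE mulrBl.
Qed.

Lemma trigD a b gamma : trig (a + b) gamma = trig a gamma + trig b gamma.
Proof.
rewrite /trig -big_split; apply: eq_bigr => j _.
by rewrite !mxE mulrDl.
Qed.

Lemma trigZ (t : Cplx R) a gamma : trig (t *: a) gamma = t * trig a gamma.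
Proof.
by rewrite /trig mulr_sumr; apply: eq_bigr => j _; rewrite !mxE mulrA.
Qed.

Lemma trig0 gamma : trig 0 gamma = 0.
Proof. by rewrite /trig big1// => j _; rewrite mxE mul0r. Qed.

Lemma cmod_trig a gamma : cmod (trig a gamma) <= coef_size a.
Proof.
apply: le_trans (cmod_sum _) _; apply: ler_sum => j _.
by rewrite Normc.normcM cmod_echar mulr1.
Qed.

Lemma continuous_trig a : continuous (trig a).
Proof.
rewrite /trig; apply: continuous_big => [|j _].
  exact: add_continuous.
move=> gamma; apply: (@cvgM R[i] _ (nbhs gamma) _ (fun=> a ord0 j) (echar (x j))).
  exact: cvg_cst.
exact: continuous_echar.
Qed.

(** An element of [trig_poly] may repeat frequencies; collecting equal ones
gives one coefficient per frequency. *)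
Lemma trig_poly_range : trig_poly (range x) = range trig.
Proof.
apply/seteqP; split => [tau [n [a [y [xy ->]]]]|_ [a _ <-]]; last first.
  by exists k, (fun j => a ord0 j), x; split => // j; exists j.
have /choice[s ys] : forall i : 'I_n, exists j, x j = y i.
  by move=> i; have [j _ <-] := xy i; exists j.
exists (\row_j \sum_(i | s i == j) a i) => //; apply/funext => gamma.
rewrite /trig (partition_big s xpredT)//=; apply: eq_bigr => j _.
by rewrite mxE mulr_suml; apply: eq_bigr => i /eqP <-; rewrite ys.
Qed.

End Trig.

(** * Bounded continuous integrands *)

Section Integrals.
Variables (R : realType) (G : topologicalZmodType).
Local Notation BD := (borel_dual R G).
Local Notation fmeasure := {finite_measure set BD -> \bar R}.
Implicit Types (mu : fmeasure) (g : dual R G -> R).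

Lemma continuous_borel_measurable g :
  continuous g -> measurable_fun [set: BD] (g : BD -> R).
Proof.
move=> /continuousP cg.
apply: (measurability _ (@RGenOpens.measurableE R)) => _ [_ [a [b ->] <-]].
rewrite setTI; apply: sub_sigma_algebra.
by apply: cg; exact: interval_open.
Qed.

Lemma bounded_borel_integrable mu (g : BD -> R) (M : R) :
  measurable_fun [set: BD] g -> (forall gamma, `|g gamma| <= M) ->
  mu.-integrable [set: BD] (EFin \o g).
Proof.
move=> mg gM; apply: measurable_bounded_integrable => //.
  by rewrite -ge0_fin_numE// fin_num_measure.
exists M; split; first exact: num_real.
by move=> y My gamma _; apply: le_trans (gM gamma) (ltW My).
Qed.

(** Weak* convergence is stated for complex integrands; a real one is the real
part of itself. *)
Lemma wstar_cvg_real (mu : nat -> fmeasure) (mu0 : fmeasure) g (M : R) :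
  wstar_cvg mu mu0 -> continuous g -> (forall gamma, `|g gamma| <= M) ->
  (fun n => \int[mu n]_(gamma in [set: BD]) g gamma) @ \oo -->
    \int[mu0]_(gamma in [set: BD]) g gamma.
Proof.
move=> mu_cvg cg gM.
pose f gamma : Cplx R := Complex (g gamma) 0.
have cf : continuous f.
  by move=> gamma; apply: (cvg_Complex (cg gamma)); exact: cvg_cst.
have fM : exists M : R, forall gamma, cmod (f gamma) <= M.
  exists M => gamma; apply: le_trans (cmod_le_ReIm _) _.
  by rewrite /= normr0 addr0.
exact: (cvg_comp _ _ (mu_cvg f cf fM) (@continuous_Re R _)).
Qed.

End Integrals.

(** * The approximation error as a function of measure and coefficients *)

Section ApproximationError.
Variables (R : realType) (G : topologicalZmodType) (k : nat) (x : 'I_k -> G).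
Variable p : R.
Hypothesis p_gt0 : 0 < p.
Local Notation BD := (borel_dual R G).
Local Notation fmeasure := {finite_measure set BD -> \bar R}.
Implicit Types (mu : fmeasure) (c : Cplx R) (a b : 'rV[Cplx R]_k).

Let integrand c a : dual R G -> R :=
  fun gamma => cmod (c - trig x a gamma) `^ p.

(** The p-th power of the distance from the constant [c] to a trigonometric
polynomial.  The cases of interest are [c = 1], the quantity that [d_p]
minimizes, and [c = 0], the p-homogeneous functional that measures the size of
[trig x a] in [L^p(mu)]. *)
Definition err mu c a : R := \int[mu]_(gamma in [set: BD]) integrand c a gamma.

Let cmod_bound c a gamma : cmod (c - trig x a gamma) <= cmod c + coef_size a.
Proof.
apply: le_trans (le_normcD _ _) _; rewrite lerD2l normcN; exact: cmod_trig.
Qed.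

Lemma continuous_cmodB_trig c a :
  continuous (fun gamma => cmod (c - trig x a gamma)).
Proof.
move=> gamma; apply: (@continuous_comp _ _ _ (fun gamma => c - trig x a gamma)
  (fun z : Cplx R => cmod z)); last exact: continuous_cmod.
apply: (@cvgB R[i] R[i]^o _ (nbhs gamma) _ (fun=> c) (trig x a)).
  exact: cvg_cst.
exact: continuous_trig.
Qed.

Let integrand_ge0 c a gamma : 0 <= integrand c a gamma.
Proof. exact: powR_ge0. Qed.

Let integrand_bound c a gamma :
  `|integrand c a gamma| <= (cmod c + coef_size a) `^ p.
Proof.
rewrite ger0_norm//; apply: ge0_ler_powR => //; first exact: ltW.
  by rewrite nnegrE cmod_ge0.
by rewrite nnegrE addr_ge0 ?cmod_ge0 ?coef_size_ge0.
Qed.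

Let continuous_integrand c a : continuous (integrand c a).
Proof.
have -> : integrand c a = (fun t : R => `|t| `^ p) \o
    (fun gamma => cmod (c - trig x a gamma)).
  by apply/funext => gamma /=; rewrite ger0_norm ?cmod_ge0.
move=> gamma; apply: continuous_comp; last exact: continuous_norm_powR.
exact: continuous_cmodB_trig.
Qed.

Let measurable_integrand c a : measurable_fun [set: BD] (integrand c a : BD -> R).
Proof. exact: continuous_borel_measurable (@continuous_integrand c a). Qed.

Let integrable_integrand mu c a :
  mu.-integrable [set: BD] (EFin \o (integrand c a : BD -> R)).
Proof.
exact: bounded_borel_integrable (measurable_integrand c a) (integrand_bound c a).
Qed.

Lemma Lp_dist_err mu c a : Lp_dist mu p (fun=> c) (trig x a) = (err mu c a)%:E.
Proof.
rewrite /err /Rintegral fineK//.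
exact: integrable_fin_num (integrable_integrand mu c a).
Qed.

Lemma err_ge0 mu c a : 0 <= err mu c a.
Proof. exact: Rintegral_ge0. Qed.

Lemma err_cvg (mu : nat -> fmeasure) (mu0 : fmeasure) c a :
  wstar_cvg mu mu0 -> (fun n => err (mu n) c a) @ \oo --> err mu0 c a.
Proof.
move=> mu_cvg.
exact: (wstar_cvg_real mu_cvg (@continuous_integrand c a) (integrand_bound c a)).
Qed.

Lemma mass_cvg (mu : nat -> fmeasure) (mu0 : fmeasure) :
  wstar_cvg mu mu0 -> (fun n => fine (mu n [set: BD])) @ \oo -->
  fine (mu0 [set: BD]).
Proof.
move=> mu_cvg.
have cst1 : continuous (fun _ : dual R G => 1 : R) by exact: cst_continuous.
have b1 (gamma : dual R G) : `|1 : R| <= 1 by rewrite normr1.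
have mass (nu : fmeasure) : fine (nu [set: BD]) = \int[nu]_(_ in [set: BD]) (1 : R).
  by rewrite Rintegral_cst// mul1r.
by rewrite mass (funext (fun n => mass (mu n))); exact: wstar_cvg_real cst1 b1.
Qed.

(** Joint continuity in the measure and the coefficients.  The masses of
[mu n] are eventually below [B = mu0(Gamma) + 1], so a uniform change of the
integrand by less than [e / 2 / B] costs at most [e / 2]; the rest is weak*
convergence for the fixed coefficients [a]. *)
Lemma err_near (mu : nat -> fmeasure) (mu0 : fmeasure) c a (e : R) :
  wstar_cvg mu mu0 -> 0 < e ->
  \forall b \near a & n \near \oo, `|err (mu n) c b - err mu0 c a| < e.
Proof.
move=> mu_cvg e0.
pose B := fine (mu0 [set: BD]) + 1.
have B0 : 0 < B by rewrite ltr_wpDl// fine_ge0.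
pose e' := e / 2 / B.
have e'0 : 0 < e' by rewrite !divr_gt0.
have [d d0 dP] := powR_uniform p_gt0 (cmod c + coef_size a) e'0.
exists ([set b | coef_size (b - a) < d],
  [set n | fine (mu n [set: BD]) < B /\ `|err mu0 c a - err (mu n) c a| < e / 2]).
  split; first exact: near_coef_size.
  near=> n; split; near: n.
    apply: (cvgr_lt (fine (mu0 [set: BD])) (mass_cvg mu_cvg)).
    by rewrite ltrDl.
  by have /cvgrPdist_lt := @err_cvg _ _ c a mu_cvg; apply; rewrite divr_gt0.
move=> [b n] [/= bd [nB na]].
rewrite (splitr e) (le_lt_trans (ler_distD (err (mu n) c a) _ _))//.
rewrite ler_ltD//; last by rewrite distrC.
have ib := integrable_integrand (mu n) c b.
have ia := integrable_integrand (mu n) c a.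
have iba : (mu n).-integrable [set: BD]
    (EFin \o (fun gamma : BD => integrand c b gamma - integrand c a gamma)).
  exact: (integrableB measurableT ib ia).
rewrite /err -RintegralB// (le_trans (le_normr_Rintegral _ _))//.
apply: (@le_trans _ _ (\int[mu n]_(gamma in [set: BD]) e')).
  apply: le_Rintegral => //; [exact: integrable_norm| |move=> gamma _].
    by apply: (@bounded_borel_integrable _ _ _ _ e') => // ?; rewrite gtr0_norm.
  rewrite distrC; apply/ltW/dP; rewrite ?cmod_ge0 ?cmod_bound//.
  rewrite (le_lt_trans (cmod_dist _ _))// opprB addrC addrA subrK.
  by rewrite -trigB (le_lt_trans (cmod_trig _ _ _)).
rewrite Rintegral_cst// -ler_pdivlMl// /e' invf_div.
by rewrite divfK ?gt_eqF ?divr_gt0// ltW.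
Unshelve. all: by end_near. Qed.

Lemma err_near0 (mu : fmeasure) c a (e : R) : 0 < e ->
  \forall b \near a, `|err mu c b - err mu c a| < e.
Proof.
move=> e0.
have cst_cvg : wstar_cvg (fun=> mu) mu by move=> f _ _; exact: cvg_cst.
have [[/= U V] [Ua Voo] UV] := err_near c a cst_cvg e0.
have [n Vn] := filter_ex Voo.
by apply: filterS Ua => b Ub; exact: (UV (b, n)).
Qed.

Lemma errZ mu (t : Cplx R) a : err mu 0 (t *: a) = cmod t `^ p * err mu 0 a.
Proof.
rewrite /err -RintegralZl//; last exact: integrable_integrand.
apply: eq_Rintegral => gamma _; rewrite /integrand trigZ !sub0r !normcN.
by rewrite Normc.normcM powRM ?cmod_ge0.
Qed.

Lemma err00 mu : err mu 0 0 = 0.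
Proof.
have := errZ mu 0 0; rewrite scale0r Normc.normc0 powR0 ?gt_eqF//.
by rewrite mul0r.
Qed.

(** Bounding [|T a|^p] by [2^p (|1 - T a|^p + 1)] turns a bound on the
approximation error into a bound on the polynomial. *)
Lemma err0_le_err1 mu a : err mu 0 a <=
  2 `^ p * (err mu 1 a + fine (mu [set: BD])).
Proof.
have i1 : mu.-integrable [set: BD] (EFin \o (fun=> 1 : R)).
  by apply: (@bounded_borel_integrable _ _ _ _ 1) => // ?; rewrite normr1.
have ia := integrable_integrand mu 1 a.
have i1a : mu.-integrable [set: BD]
    (EFin \o (fun gamma : BD => integrand 1 a gamma + 1)).
  exact: (integrableD measurableT ia i1).
rewrite -[fine _]mul1r -Rintegral_cst// /err -RintegralD// -RintegralZl//.
apply: le_Rintegral => //.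
- exact: integrable_integrand.
- exact: (integrableZl measurableT _ i1a).
move=> gamma _; rewrite /integrand.
have := powR_add_le p_gt0 (cmod_ge0 (1 - trig x a gamma)) (cmod_ge0 1).
rewrite [in X in _ <= X]Normc.normc1 powR1; apply: le_trans.
apply: ge0_ler_powR; rewrite ?nnegrE ?addr_ge0 ?cmod_ge0//; first exact: ltW.
rewrite -(normcN (1 - _)) (le_trans _ (le_normcD _ _))//.
by rewrite sub0r normcN opprB subrK.
Qed.

Lemma err0_le mu a : err mu 0 a <= coef_size a `^ p * fine (mu [set: BD]).
Proof.
rewrite -Rintegral_cst//; apply: le_Rintegral => //.
- exact: integrable_integrand.
- apply: (@bounded_borel_integrable _ _ _ _ (coef_size a `^ p)) => // gamma.
  by rewrite ger0_norm ?powR_ge0.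
move=> gamma _; apply: le_trans (ler_norm _) _.
by have := integrand_bound 0 a gamma; rewrite Normc.normc0 add0r.
Qed.

(** The average of the two integrands minus the integrand at the midpoint is
nonnegative, vanishes only where the polynomials agree, and has integral zero. *)
Lemma err_midpoint mu c a b : 1 < p ->
  err mu c a + err mu c b <=
    2 * err mu c ((2^-1 : Cplx R) *: (a + b)) ->
  {ae mu, forall gamma : BD, trig x a gamma = trig x b gamma}.
Proof.
move=> p1; set m := _ *: _ => mid.
pose D gamma := (integrand c a gamma + integrand c b gamma) - 2 * integrand c m gamma.
have mE gamma : integrand c m gamma =
    (2^-1 * cmod ((c - trig x a gamma) + (c - trig x b gamma))) `^ p.
  by rewrite /integrand trigZ trigD cmod_midpoint_sub.
have Dlt gamma : trig x a gamma != trig x b gamma -> 0 < D gamma.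
  move=> ab; rewrite /D mE.
  have uv : c - trig x a gamma != c - trig x b gamma.
    by apply: contra ab => /eqP/addrI/oppr_inj ->.
  by rewrite subr_gt0 mulrC -ltr_pdivlMr//; exact: cmod_midpoint_powR_lt.
have D0 gamma : 0 <= D gamma.
  have [ab|/Dlt/ltW//] := eqVneq (trig x a gamma) (trig x b gamma).
  rewrite /D mE /integrand ab.
  rewrite cmod_double mulKf//.
  by rewrite mulr_natl mulr2n subrr.
have ia := integrable_integrand mu c a.
have ib := integrable_integrand mu c b.
have im := integrable_integrand mu c m.
have iab : mu.-integrable [set: BD]
    (EFin \o (fun gamma : BD => integrand c a gamma + integrand c b gamma)).
  exact: (integrableD measurableT ia ib).
have i2m : mu.-integrable [set: BD]
    (EFin \o (fun gamma : BD => 2 * integrand c m gamma)).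
  exact: (integrableZl measurableT _ im).
have iD : mu.-integrable [set: BD] (EFin \o (D : BD -> R)).
  exact: (integrableB measurableT iab i2m).
have intD : (\int[mu]_(gamma in [set: BD]) D gamma = 0)%R.
  apply/eqP; rewrite eq_le Rintegral_ge0// andbT.
  by rewrite /D RintegralB// RintegralD// RintegralZl// subr_le0.
have /integrableP[mD _] := iD.
have [+ _] := ae_eq_integral_abs mu measurableT mD.
have -> : (\int[mu]_gamma `|(EFin \o (D : BD -> R)) gamma| = 0)%E.
  rewrite -[RHS](congr1 EFin intD) /Rintegral fineK; last exact: integrable_fin_num iD.
  by apply: eq_integral => gamma _; rewrite gee0_abs// lee_fin.
move=> /(_ erefl); apply: filterS => gamma /(_ I) [] Dg.
by apply/eqP; apply: contraTT isT => /Dlt; rewrite Dg ltxx.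
Qed.

End ApproximationError.

(** * Coercivity and convergence of the least errors *)

Section Convergence.
Variables (R : realType) (G : topologicalZmodType) (k : nat) (x : 'I_k -> G).
Variable p : R.
Hypothesis p_gt0 : 0 < p.
Local Notation BD := (borel_dual R G).
Local Notation fmeasure := {finite_measure set BD -> \bar R}.
Implicit Types (mu : fmeasure) (a b : 'rV[Cplx R]_k).
Local Notation err := (err x p).

Definition trig_indep mu :=
  forall a, {ae mu, forall gamma : BD, trig x a gamma = 0} -> a = 0.

Lemma ae_eq_of_Lp_dist0 mu (f g : dual R G -> Cplx R) :
  measurable_fun [set: BD] (fun gamma : BD => cmod (f gamma - g gamma)) ->
  Lp_dist mu p f g = 0%E -> {ae mu, forall gamma : BD, f gamma = g gamma}.
Proof.
move=> mfg fg0.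
have mh : measurable_fun [set: BD]
    (fun gamma : BD => (cmod (f gamma - g gamma) `^ p)%:E).
  apply/measurable_EFinP.
  exact: (measurableT_comp (@measurable_powR R p) mfg).
have [+ _] := ae_eq_integral_abs mu measurableT mh.
have -> : (\int[mu]_gamma `|(cmod (f gamma - g gamma) `^ p)%:E| = Lp_dist mu p f g)%E.
  by apply: eq_integral => gamma _; rewrite /= ger0_norm ?powR_ge0.
move=> /(_ fg0); apply: filterS => gamma /(_ I) [] /powR_eq0_eq0/Normc.eq0_normc.
by move/subr0_eq.
Qed.

Lemma err_eq0 mu a : trig_indep mu -> err mu 0 a = 0 -> a = 0.
Proof.
move=> indep a0; apply: indep.
have a0' : Lp_dist mu p (fun=> 0) (trig x a) = 0%E by rewrite Lp_dist_err ?a0.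
apply: filterS (ae_eq_of_Lp_dist0 _ a0') => [gamma <- //|].
exact: continuous_borel_measurable (@continuous_cmodB_trig _ _ _ x 0 a).
Qed.

(** By homogeneity it is enough to find [c] on the unit sphere.  Each point of
the closed unit ball has a neighbourhood in which, for small [c] and large [n],
the bound holds on the sphere: points of the sphere by [err_near] and
independence, inner points because the sphere stays away from them. *)
Lemma err_coercive (mu : nat -> fmeasure) (mu0 : fmeasure) :
  trig_indep mu0 -> wstar_cvg mu mu0 ->
  exists2 c : R, 0 < c &
    \forall n \near \oo, forall a, c * coef_size a `^ p <= err (mu n) 0 a.
Proof.
move=> indep mu_cvg.
(* Restricting to the sphere inside [P] lets the compact set be the closed ball,
   with a vacuous bound off the sphere. *)
pose P (cn : R * nat) b := coef_size b = 1 -> cn.1 <= err (mu cn.2) 0 b.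
have /compact_near_coveringP/(_ _ (filter_prod (0 : R)^'+ \oo) P) cvr :=
  @compact_coef_size R k 1.
have [a /=|[A B] /= [A0 Boo] ABP] := cvr _.
  rewrite le_eqVlt => /orP[/eqP a1|a1].
    have erra : 0 < err mu0 0 a.
      rewrite lt0r err_ge0 andbT; apply/eqP => /(err_eq0 indep) a0.
      move: a1; rewrite a0 -(scale0r 0) coef_sizeZ Normc.normc0 mul0r.
      by move/esym/eqP; rewrite oner_eq0.
    have e0 : 0 < err mu0 0 a / 2 by rewrite divr_gt0.
    have [[U V] /= [Ua Voo] UV] := err_near x p_gt0 0 a mu_cvg e0.
    exists (U, ([set c | c < err mu0 0 a / 2] `*` V)) => /=.
      split => //; exists ([set c | c < err mu0 0 a / 2], V) => //.
      by split => //=; exact: nbhs_right_lt.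
    move=> [b [c n]] /= [Ub [ce Vn]] _ /=.
    have /= := UV (b, n) (conj Ub Vn); rewrite ltr_norml => /andP[h _].
    lra.
  have d0 : 0 < 1 - coef_size a by rewrite subr_gt0.
  exists ([set b | coef_size (b - a) < 1 - coef_size a], setT) => /=.
    by split; [exact: near_coef_size|exact: filterT].
  move=> [b cn] /= [ba _] b1.
  have := coef_sizeD (b - a) a; rewrite subrK b1 => h.
  lra.
have [c [Ac c0]] : exists c, A c /\ 0 < c.
  near (0 : R)^'+ => c; exists c; split; last exact: (near (nbhs_right_gt _) c).
  exact: (near A0 c).
exists c => //; apply: filterS Boo => n Bn a.
have [a0|a0] := eqVneq (coef_size a) 0.
  by rewrite a0 powR0 ?gt_eqF// mulr0 err_ge0.
have s0 : 0 < coef_size a by rewrite lt0r a0 coef_size_ge0.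
pose t : Cplx R := Complex (coef_size a)^-1 0.
have ct : cmod t = (coef_size a)^-1 by rewrite cmod_real// invr_ge0 ltW.
have := ABP (c, n) (conj Ac Bn) (t *: a).
rewrite /P /= coef_sizeZ ct mulVf// lexx => /(_ isT erefl).
rewrite (errZ _ p_gt0) ct -(powR_inv1 (ltW s0)) -powRrM mulN1r powRN.
by rewrite ler_pdivlMl ?powR_gt0// mulrC.
Unshelve. all: by end_near. Qed.

(** The real number whose image in the extended reals is [d_p]. *)
Definition least_err mu : R := inf (range (err mu 1)).

Let has_inf_err mu : has_inf (range (err mu 1)).
Proof.
split; first by exists (err mu 1 0), 0.
by exists 0 => _ [a _ <-]; exact: err_ge0.
Qed.

Lemma d_p_least_err mu : d_p mu p (range x) = (least_err mu)%:E.
Proof.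
rewrite /least_err -ereal_inf_EFin//; [|by case: (has_inf_err mu)..].
rewrite /d_p trig_poly_range; congr (ereal_inf _).
apply/seteqP; split => [_ [_ [a _ <-] <-]|_ [_ [a _ <-] <-]].
  by exists (err mu 1 a); [exists a|rewrite Lp_dist_err].
by exists (trig x a); [exists a|rewrite Lp_dist_err].
Qed.

Lemma least_err_le mu a : least_err mu <= err mu 1 a.
Proof. by apply: ge_inf; [case: (has_inf_err mu)|exists a]. Qed.

Lemma le_least_err mu d : (forall a, d <= err mu 1 a) -> d <= least_err mu.
Proof.
by move=> da; apply: lb_le_inf => [|_ [a _ <-]//]; case: (has_inf_err mu).
Qed.

Lemma least_err_adherent mu (e : R) : 0 < e -> exists a, err mu 1 a < least_err mu + e.
Proof. by move=> /inf_adherent/(_ (has_inf_err mu))[_ [a _ <-]]; exists a. Qed.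

Lemma least_err_ge0 mu : 0 <= least_err mu.
Proof. by apply: le_least_err => a; exact: err_ge0. Qed.

Lemma near_minimizer_bounded (mu : nat -> fmeasure) (mu0 : fmeasure) (E : R) :
  trig_indep mu0 -> wstar_cvg mu mu0 ->
  exists M : R, \forall n \near \oo, forall a,
    err (mu n) 1 a <= E -> coef_size a <= M.
Proof.
move=> indep mu_cvg; have [c c0 coer] := err_coercive indep mu_cvg.
pose B := fine (mu0 [set: BD]) + 1.
exists ((2 `^ p * (E + B) / c) `^ p^-1).
have mB : \forall n \near \oo, fine (mu n [set: BD]) < B.
  by apply: (cvgr_lt (fine (mu0 [set: BD])) (mass_cvg mu_cvg)); rewrite ltrDl.
apply: filterS2 mB coer => n mB coer a aE.
apply: powR_le_root => //; first exact: coef_size_ge0.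
rewrite ler_pdivlMr// mulrC (le_trans (coer a))//.
rewrite (le_trans (err0_le_err1 x p_gt0 _ a))// ler_wpM2l ?powR_ge0//.
by rewrite lerD// ltW.
Qed.

Lemma err_lower_on_ball (mu : nat -> fmeasure) (mu0 : fmeasure) (M e : R) :
  wstar_cvg mu mu0 -> 0 < e ->
  \forall n \near \oo, forall a, coef_size a <= M ->
    least_err mu0 - e < err (mu n) 1 a.
Proof.
move=> mu_cvg e0.
pose P n a := least_err mu0 - e < err (mu n) 1 a.
have /compact_near_coveringP/(_ _ \oo P) := @compact_coef_size R k M.
apply => a _; have [[U V] /= [Ua Voo] UV] := err_near x p_gt0 1 a mu_cvg e0.
exists (U, V) => // -[b n] /= [Ub Vn].
have /= := UV (b, n) (conj Ub Vn); rewrite ltr_norml => /andP[h _].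
have := least_err_le mu0 a; rewrite /P; lra.
Qed.

(** Upper semicontinuity: a fixed near-minimizer for [mu0] is a competitor for
every [mu n]. *)
Lemma least_err_upper (mu : nat -> fmeasure) (mu0 : fmeasure) (e : R) :
  wstar_cvg mu mu0 -> 0 < e -> \forall n \near \oo, least_err (mu n) < least_err mu0 + e.
Proof.
move=> mu_cvg e0; have [a ae] := least_err_adherent mu0 e0.
near=> n; apply: le_lt_trans (least_err_le _ a) _; near: n.
exact: (cvgr_lt _ (@err_cvg _ _ _ x p p_gt0 _ _ 1 a mu_cvg)).
Unshelve. all: by end_near. Qed.

(** Coefficients outside the ball of [near_minimizer_bounded] have error above
[least_err mu0] anyway; on the ball [err_lower_on_ball] applies. *)
Lemma least_err_cvg_indep (mu : nat -> fmeasure) (mu0 : fmeasure) :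
  trig_indep mu0 -> wstar_cvg mu mu0 -> (least_err \o mu) @ \oo --> least_err mu0.
Proof.
move=> indep mu_cvg; apply/cvgrPdist_le => e e0.
have [M bM] := near_minimizer_bounded (least_err mu0) indep mu_cvg.
apply: filterS3 bM (err_lower_on_ball M mu_cvg e0) (least_err_upper mu_cvg e0) => n.
move=> bM low up; rewrite ler_distl lerBlDr ltW//=.
rewrite -lerBlDr; apply: le_least_err => a.
have [/bM/low/ltW//|/ltW] := leP (err (mu n) 1 a) (least_err mu0).
by apply: le_trans; rewrite gerBl ltW.
Qed.

Lemma least_err_cvg_zero (mu : nat -> fmeasure) (mu0 : fmeasure) :
  least_err mu0 = 0 -> wstar_cvg mu mu0 -> (least_err \o mu) @ \oo --> least_err mu0.
Proof.
move=> b0 mu_cvg; apply/cvgrPdist_le => e e0.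
apply: filterS (least_err_upper mu_cvg e0) => n; rewrite b0 add0r => ne.
by rewrite sub0r normrN ger0_norm ?least_err_ge0// ltW.
Qed.

End Convergence.

(** * The functional Lp_dist on measurable functions *)

Section LpDistance.
Variables (R : realType) (G : topologicalZmodType) (p : R).
Hypothesis p_gt0 : 0 < p.
Local Notation BD := (borel_dual R G).
Variable mu : {measure set BD -> \bar R}.
Implicit Types f g h : dual R G -> Cplx R.

Definition cmeasurable f :=
  measurable_fun [set: BD] (fun gamma : BD => complex.Re (f gamma)) /\
  measurable_fun [set: BD] (fun gamma : BD => complex.Im (f gamma)).

Lemma continuous_cmeasurable f : continuous f -> cmeasurable f.
Proof.
move=> cf; split; apply: continuous_borel_measurable => gamma.
  apply: (@continuous_comp _ _ _ f (@complex.Re R)); first exact: cf.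
  exact: continuous_Re.
apply: (@continuous_comp _ _ _ f (@complex.Im R)); first exact: cf.
exact: continuous_Im.
Qed.

Lemma measurable_cmodB f g : cmeasurable f -> cmeasurable g ->
  measurable_fun [set: BD] (fun gamma : BD => cmod (f gamma - g gamma)).
Proof.
move=> [fr fi] [gr gi].
have -> : (fun gamma : BD => cmod (f gamma - g gamma)) = (fun t => t `^ 2^-1) \o
  (fun gamma : BD => (complex.Re (f gamma) - complex.Re (g gamma)) ^+ 2 +
                     (complex.Im (f gamma) - complex.Im (g gamma)) ^+ 2).
  apply/funext => gamma /=; rewrite powR12_sqrt ?addr_ge0 ?sqr_ge0//.
  by case: (f gamma) (g gamma) => [a b] [c d].
apply: (measurableT_comp (@measurable_powR R 2^-1)).
by apply: measurable_funD; apply: measurable_funX; exact: measurable_funB.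
Qed.

Lemma measurable_Lp_integrand f g : cmeasurable f -> cmeasurable g ->
  measurable_fun [set: BD] (fun gamma : BD => (cmod (f gamma - g gamma) `^ p)%:E).
Proof.
move=> mf mg; apply/measurable_EFinP.
exact: (measurableT_comp (@measurable_powR R p) (measurable_cmodB mf mg)).
Qed.

Lemma Lp_distC f g : Lp_dist mu p f g = Lp_dist mu p g f.
Proof. by apply: eq_integral => gamma _; rewrite -normcN opprB. Qed.

Lemma Lp_dist_ge0 f g : (0 <= Lp_dist mu p f g)%E.
Proof. by apply: integral_ge0 => gamma _; rewrite lee_fin powR_ge0. Qed.

Lemma Lp_dist_quasi f g h : cmeasurable f -> cmeasurable g -> cmeasurable h ->
  (Lp_dist mu p f h <= (2 `^ p)%:E * (Lp_dist mu p f g + Lp_dist mu p g h))%E.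
Proof.
move=> mf mg mh.
have fg := measurable_Lp_integrand mf mg.
have gh := measurable_Lp_integrand mg mh.
have fh := measurable_Lp_integrand mf mh.
have ge0 (f1 f2 : dual R G -> Cplx R) (gamma : BD) :
  (0 <= (cmod (f1 gamma - f2 gamma) `^ p)%:E)%E by rewrite lee_fin powR_ge0.
rewrite /Lp_dist -ge0_integralD// -ge0_integralZl ?lee_fin ?powR_ge0//; last 2 first.
- exact: emeasurable_funD.
- by move=> gamma _; rewrite adde_ge0.
apply: ge0_le_integral => //.
- by apply: measurable_funeM; exact: emeasurable_funD.
move=> gamma _; rewrite -EFinD -EFinM lee_fin.
apply: le_trans (powR_add_le p_gt0 (cmod_ge0 _) (cmod_ge0 _)).
apply: ge0_ler_powR; rewrite ?nnegrE ?addr_ge0 ?cmod_ge0//; first exact: ltW.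
by have := le_normcD (f gamma - g gamma) (g gamma - h gamma); rewrite addrA subrK.
Qed.

Lemma ae_eq_Lp_dist (f f' g g' : dual R G -> Cplx R) :
  cmeasurable f -> cmeasurable f' -> cmeasurable g -> cmeasurable g' ->
  {ae mu, forall gamma : BD, f gamma = f' gamma} ->
  {ae mu, forall gamma : BD, g gamma = g' gamma} ->
  Lp_dist mu p f g = Lp_dist mu p f' g'.
Proof.
move=> mf mf' mg mg' ff' gg'; apply: ge0_ae_eq_integral => //.
- exact: measurable_Lp_integrand.
- exact: measurable_Lp_integrand.
- by move=> gamma _; rewrite lee_fin powR_ge0.
- by move=> gamma _; rewrite lee_fin powR_ge0.
by apply: filterS2 ff' gg' => gamma ff gg _; rewrite ff gg.
Qed.

End LpDistance.

(** * Minimizers and metric projections *)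

(** Local lower bounds are what a quasi-triangle inequality provides, where
lower semicontinuity would require the triangle inequality itself. *)
Lemma compact_lower_bound (R : realType) (T : topologicalType) (K : set T)
    (Phi : T -> \bar R) :
  compact K ->
  (forall a, K a -> exists2 r : R, 0 < r & \forall b \near a, (r%:E <= Phi b)%E) ->
  exists2 r : R, 0 < r & forall b, K b -> (r%:E <= Phi b)%E.
Proof.
move=> cK loc; pose P (r : R) b := (r%:E <= Phi b)%E.
have /compact_near_coveringP/(_ _ (0 : R)^'+ P) cvr := cK.
have {}cvr : \forall r \near (0 : R)^'+, K `<=` P r.
  apply: cvr => a /loc[r r0 ar].
  exists ([set b | (r%:E <= Phi b)%E], [set s | s < r]).
    by split => //; exact: nbhs_right_lt.
  by move=> [b s] /= [rb sr]; rewrite /P (le_trans _ rb)// lee_fin ltW.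
near (0 : R)^'+ => r; exists r; first exact: (near (nbhs_right_gt _) r).
exact: (near cvr r).
Unshelve. all: by end_near. Qed.

Lemma half_gap_lt (R : realType) (u v w : R) :
  `|v - u| < (u - w) / 2 -> (u - w) / 2 < v - w.
Proof. rewrite ltr_norml => /andP[+ _]; lra. Qed.

Section Minimizers.
Variables (R : realType) (G : topologicalZmodType) (k : nat) (x : 'I_k -> G).
Variable p : R.
Hypothesis p_gt0 : 0 < p.
Local Notation BD := (borel_dual R G).
Local Notation fmeasure := {finite_measure set BD -> \bar R}.
Implicit Types (mu : fmeasure) (a b : 'rV[Cplx R]_k).
Local Notation err := (err x p).
Local Notation least_err := (least_err x p).

Lemma wstar_cvg_cst mu : wstar_cvg (fun=> mu) mu.
Proof. by move=> f _ _; exact: cvg_cst. Qed.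

Lemma trig_cmeasurable a : cmeasurable (trig x a).
Proof. exact: continuous_cmeasurable (@continuous_trig _ _ _ x a). Qed.

Lemma cst_cmeasurable (c : Cplx R) : cmeasurable (fun _ : dual R G => c).
Proof. by split; exact: measurable_cst. Qed.

Lemma minimizer_bounded mu (E : R) : trig_indep x mu ->
  exists M : R, forall a, err mu 1 a <= E -> coef_size a <= M.
Proof.
move=> indep.
have [M bM] := near_minimizer_bounded p_gt0 E indep (@wstar_cvg_cst mu).
by exists M; have [n] := filter_ex bM.
Qed.

(** Were the infimum not attained, the error would exceed it by a fixed amount
on the ball that contains all near-minimizers. *)
Lemma minimizer_exists mu : trig_indep x mu -> exists a, err mu 1 a = least_err mu.
Proof.
move=> indep; apply: contrapT => /forallNP noa.
have [M bM] := minimizer_bounded (least_err mu + 1) indep.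
have [a _|r r0 rM] := @compact_lower_bound R _ _
    (fun a => (err mu 1 a - least_err mu)%:E) (@compact_coef_size R k M).
  have d0 : 0 < err mu 1 a - least_err mu.
    by rewrite subr_gt0 lt_neqAle least_err_le// andbT; apply/eqP => /esym/noa.
  exists ((err mu 1 a - least_err mu) / 2); first by rewrite divr_gt0.
  have : 0 < (err mu 1 a - least_err mu) / 2 by rewrite divr_gt0.
  move=> /(err_near0 x p_gt0 mu 1 a); apply: filterS => b /half_gap_lt/ltW.
  by rewrite lee_fin.
have m0 : 0 < Num.min r 1 by rewrite lt_min r0 ltr01.
have [a am] := least_err_adherent x p mu m0.
rewrite -ltrBlDl lt_min in am; case/andP: am => ar a1.
have /bM/rM : err mu 1 a <= least_err mu + 1 by rewrite -lerBlDl ltW.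
by rewrite lee_fin leNgt ar.
Qed.

Lemma minimizer_unique mu a b : 1 < p -> trig_indep x mu ->
  err mu 1 a = least_err mu -> err mu 1 b = least_err mu -> a = b.
Proof.
move=> p1 indep am bm; apply/subr0_eq/indep.
have : err mu 1 a + err mu 1 b <= 2 * err mu 1 ((2^-1 : Cplx R) *: (a + b)).
  by rewrite am bm -mulr2n -[least_err mu *+ 2]mulr_natl ler_pM2l// least_err_le.
move=> /(err_midpoint p_gt0 p1); apply: filterS => gamma ab.
by rewrite trigB ab subrr.
Qed.

Lemma Lp_dist_trig mu a b : Lp_dist mu p (trig x a) (trig x b) = (err mu 0 (b - a))%:E.
Proof.
rewrite -(Lp_dist_err x p_gt0 mu 0 (b - a)) /Lp_dist.
by apply: eq_integral => gamma _; rewrite sub0r trigB opprB.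
Qed.

Lemma err0B_near mu a (e : R) : 0 < e -> \forall b \near a, err mu 0 (b - a) < e.
Proof.
move=> e0; pose B := fine (mu [set: BD]) + 1.
have B0 : 0 < B by rewrite ltr_wpDl// fine_ge0.
have eB : 0 < e / B by rewrite divr_gt0.
near=> b; have ba : coef_size (b - a) < (e / B) `^ p^-1.
  by near: b; apply: near_coef_size; rewrite powR_gt0.
apply: le_lt_trans (err0_le x p_gt0 mu (b - a)) _.
apply: (@le_lt_trans _ _ (e / B * fine (mu [set: BD]))).
  rewrite ler_wpM2r ?fine_ge0//.
  have -> : e / B = ((e / B) `^ p^-1) `^ p.
    by rewrite -powRrM mulVf ?gt_eqF// powRr1// ltW.
  by apply: ge0_ler_powR; rewrite ?nnegrE ?powR_ge0 ?coef_size_ge0 ?ltW.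
by rewrite mulrAC ltr_pdivrMr// ltr_pM2l// ltrDl.
Unshelve. all: by end_near. Qed.

(** The span of the characters is closed.  Polynomials within distance [1] of
[phi] have bounded coefficients; were the distance to [phi] positive for all
coefficients, it would be bounded below on that ball, since by the
quasi-triangle inequality it cannot drop sharply, and [phi] would not be in the
closure. *)
Lemma Lp_closure_trig mu phi : trig_indep x mu -> cmeasurable phi ->
  Lp_closure mu p (trig_poly (range x)) phi ->
  exists a, {ae mu, forall gamma : BD, phi gamma = trig x a gamma}.
Proof.
move=> indep mphi [[_ _ phi_fin] phi_cl].
pose C : R := 2 `^ p.
have C0 : 0 < C by rewrite powR_gt0.
have mt := trig_cmeasurable.
have mc := cst_cmeasurable.
suff [a a0] : exists a, Lp_dist mu p phi (trig x a) = 0%E.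
  by exists a; apply: ae_eq_of_Lp_dist0 a0; exact: measurable_cmodB.
apply: contrapT => /forallNP noa.
have [M bM] : exists M : R, forall a,
    (Lp_dist mu p phi (trig x a) <= 1%:E)%E -> coef_size a <= M.
  pose I := fine (Lp_dist mu p phi (fun=> 0)).
  have IE : Lp_dist mu p phi (fun=> 0) = I%:E.
    by rewrite fineK// ge0_fin_numE// Lp_dist_ge0.
  have [c c0 coer] := err_coercive p_gt0 indep (@wstar_cvg_cst mu).
  have [n {}coer] := filter_ex coer.
  exists ((C * (I + 1) / c) `^ p^-1) => a aE.
  apply: powR_le_root => //; first exact: coef_size_ge0.
  rewrite ler_pdivlMr// mulrC (le_trans (coer a))// -lee_fin -Lp_dist_err//.
  apply: le_trans (Lp_dist_quasi p_gt0 mu (mc 0) mphi (mt a)) _.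
  by rewrite Lp_distC IE EFinM EFinD lee_pmul2l// leeD2l.
have [a _|r r0 rM] := @compact_lower_bound R _ _
    (fun a => Lp_dist mu p phi (trig x a)) (@compact_coef_size R k M).
  have Da : (0 < Lp_dist mu p phi (trig x a))%E.
    by rewrite lt_def Lp_dist_ge0 andbT; apply/eqP/noa.
  have [r r0 ra] : exists2 r : R, 0 < r & (r%:E <= Lp_dist mu p phi (trig x a))%E.
    case: (Lp_dist _ _ _ _) Da => [r|_|//]; last by exists 1; rewrite ?leey.
    by rewrite lte_fin => r0; exists r.
  (* Any [s] with [2 C s < r] works: [C (s + s)] bounds the distance at [a] if
     both the distance at [b] and the size of [b - a] are at most [s]. *)
  pose s := r / C / 3.
  have s0 : 0 < s by rewrite !divr_gt0.
  exists s => //; near=> b.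
  rewrite leNgt; apply/negP => Db.
  have Nba : err mu 0 (b - a) < s by near: b; exact: err0B_near.
  have := Lp_dist_quasi p_gt0 mu mphi (mt b) (mt a).
  rewrite [X in (_ + X)%E]Lp_distC Lp_dist_trig leNgt => /negP; apply.
  apply: lt_le_trans ra.
  apply: (@le_lt_trans _ _ (C%:E * (s%:E + s%:E))%E).
    by rewrite lee_pmul2l// leeD// ?lee_fin ltW.
  rewrite -EFinD -EFinM lte_fin.
  have Cs : C * (s + s) = r / 3 + r / 3 by rewrite /s; field; rewrite gt_eqF.
  lra.
have m0 : 0 < Num.min r 1 by rewrite lt_min r0 ltr01.
have [tau] := phi_cl _ m0; rewrite trig_poly_range => -[a _ <-] am.
have /bM/rM : (Lp_dist mu p phi (trig x a) <= 1%:E)%E.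
  by apply: ltW; apply: lt_le_trans am _; rewrite lee_fin ge_min lexx orbT.
by move=> /le_lt_trans/(_ am); rewrite lte_fin lt_min ltxx.
Unshelve. all: by end_near. Qed.

(** The chosen element satisfies its specification because a minimizing
polynomial does; being in the closure it is itself a polynomial up to a null
set. *)
Lemma metric_projection_trig mu : trig_indep x mu ->
  exists a, [/\ err mu 1 a = least_err mu,
    cmeasurable (metric_projection mu p (range x)) &
    {ae mu, forall gamma : BD,
      metric_projection mu p (range x) gamma = trig x a gamma}].
Proof.
move=> indep; have [a0 a0m] := minimizer_exists indep.
have : is_metric_projection mu p (range x) (metric_projection mu p (range x)).
  apply: (@xgetPex _ (fun=> 0) [set phi | is_metric_projection mu p (range x) phi]).
  exists (trig x a0); split; last by rewrite Lp_dist_err// d_p_least_err// a0m.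
  split.
    have [mr mi] := trig_cmeasurable a0; split => //.
    by rewrite Lp_distC Lp_dist_err// ltry.
  move=> e e0; exists (trig x a0); first by rewrite trig_poly_range; exists a0.
  by rewrite Lp_dist_trig subrr err00.
set phi := metric_projection _ _ _ => -[phi_cl phi_d].
have mphi : cmeasurable phi by case: phi_cl => -[].
have [a phia] := Lp_closure_trig indep mphi phi_cl.
exists a; split; [apply: EFin_inj|exact: mphi|exact: phia].
rewrite -(Lp_dist_err x p_gt0) -(d_p_least_err x p_gt0) -phi_d.
have m1 := cst_cmeasurable 1.
apply: (ae_eq_Lp_dist p m1 m1 (trig_cmeasurable a) mphi); first exact: aeW.
by apply: filterS phia => gamma ->.
Qed.

(** The minimizers lie eventually in a fixed ball.  Away from [a0] uniqueness
gives [err mu0 1 b > least_err mu0], and by joint continuity points near [b] have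
error above [least_err (mu n)] for large [n], so they are not minimizers. *)
Lemma minimizers_cvg (mu : nat -> fmeasure) (mu0 : fmeasure) (a : nat -> 'rV_k) a0 :
  1 < p -> trig_indep x mu0 -> wstar_cvg mu mu0 ->
  (forall n, err (mu n) 1 (a n) = least_err (mu n)) -> err mu0 1 a0 = least_err mu0 ->
  a @ \oo --> a0.
Proof.
move=> p1 indep mu_cvg am a0m U Ua0.
have [M bM] := near_minimizer_bounded p_gt0 (least_err mu0 + 1) indep mu_cvg.
have b_cvg := least_err_cvg_indep p_gt0 indep mu_cvg.
pose P n b := b = a n -> U b.
have : \forall n \near \oo, [set b | coef_size b <= M] `<=` P n.
  have /compact_near_coveringP/(_ _ \oo P) := @compact_coef_size R k M.
  apply => b _; have [->|ba0] := eqVneq b a0.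
    by exists (U, setT) => [|[b' n] [Ub' _] _] //; split => //; exact: filterT.
  have d0 : 0 < err mu0 1 b - least_err mu0.
    rewrite subr_gt0 lt_neqAle least_err_le// andbT; apply: contra ba0 => /eqP bm.
    by apply/eqP; exact: (minimizer_unique p1 indep (esym bm) a0m).
  have d2 : 0 < (err mu0 1 b - least_err mu0) / 2 by rewrite divr_gt0.
  have [[V W] /= [Vb Woo] VW] := err_near x p_gt0 1 b mu_cvg d2.
  exists (V, W `&` [set n |
    least_err (mu n) < least_err mu0 + (err mu0 1 b - least_err mu0) / 2]).
    split => //; apply: filterI => //.
    exact: least_err_upper.
  move=> [b' n] /= [Vb' [Wn nb]] b'E; exfalso.
  have /= /half_gap_lt := VW (b', n) (conj Vb' Wn).
  by rewrite b'E am ltrBrDl => /lt_trans/(_ nb); rewrite ltxx.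
apply: filterS3 bM (least_err_upper x p_gt0 mu_cvg ltr01) => n bM up KP.
by apply: (KP (a n)) => //; apply: bM; rewrite am ltW.
Qed.

End Minimizers.

(** * Linear independence of the characters *)

Section Independence.
Variables (R : realType) (G : topologicalZmodType).
Local Notation BD := (borel_dual R G).
Local Notation fmeasure := {finite_measure set BD -> \bar R}.
Implicit Types (mu nu : fmeasure).

(** A basis of size [m] is obtained from the [m] characters by a square matrix.
Independence of the basis makes the matrix invertible, and then a relation
between the characters is a relation between the basis vectors. *)
Lemma trig_indep_of_dim (m : nat) (y : 'I_m -> G) mu (p : R) :
  Lp_subspace_of_dim mu p (trig_poly (range y)) m -> trig_indep y mu.
Proof.
move=> [_ [b [Vb indep _]]].
have /choice[A bA] : forall i, exists a, b i = trig y a.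
  by move=> i; move: (Vb i); rewrite trig_poly_range => -[a _ <-]; exists a.
pose M : 'M[R[i]]_m := \matrix_i A i.
have combE (v : 'rV[R[i]]_m) gamma :
    \sum_i v ord0 i * b i gamma = trig y (v *m M : 'rV[Cplx R]_m) gamma.
  rewrite /trig; under eq_bigr do rewrite bA /trig mulr_sumr.
  rewrite exchange_big; apply: eq_bigr => j _.
  by rewrite mxE mulr_suml; apply: eq_bigr => i _; rewrite !mxE mulrA.
have M_unit : M \in unitmx.
  rewrite -row_free_unit; apply: inj_row_free => v vM.
  apply/rowP => i; rewrite mxE; apply: (indep (fun i => v ord0 i)).
  by apply: aeW => gamma; rewrite combE vM trig0.
move=> c c0; pose v : 'rV[R[i]]_m := (c : 'rV[R[i]]_m) *m invmx M.
have cE : (c : 'rV[R[i]]_m) = v *m M by rewrite mulmxKV.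
rewrite cE (_ : v = 0) ?mul0mx//; apply/rowP => i; rewrite [RHS]mxE.
apply: (indep (fun i => v ord0 i)); apply: filterS c0 => gamma.
by rewrite combE -cE.
Qed.

Definition with_zero (k : nat) (x : 'I_k -> G) : 'I_k.+1 -> G :=
  fun i => oapp x 0 (unlift ord0 i).

Lemma range_with_zero (k : nat) (x : 'I_k -> G) :
  range (with_zero x) = range x `|` [set 0].
Proof.
apply/seteqP; split => [_ [i _ <-]|g [[j _ <-]|->]].
- by rewrite /with_zero; case: unliftP => [j|] _; [left; exists j|right].
- by exists (lift ord0 j) => //; rewrite /with_zero liftK.
- by exists ord0 => //; rewrite /with_zero unlift_none.
Qed.

Lemma trig_indep_with_zero (k : nat) (x : 'I_k -> G) mu :
  trig_indep (with_zero x) mu -> trig_indep x mu.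
Proof.
move=> indep a a0.
pose b : 'rV[Cplx R]_k.+1 := \row_i oapp (a ord0) 0 (unlift ord0 i).
have trig_b gamma : trig (with_zero x) b gamma = trig x a gamma.
  rewrite /trig big_ord_recl mxE unlift_none /= mul0r add0r.
  by apply: eq_bigr => j _; rewrite mxE /with_zero liftK.
have /rowP b0 : b = 0 by apply: indep; apply: filterS a0 => gamma; rewrite trig_b.
by apply/rowP => j; have := b0 (lift ord0 j); rewrite !mxE liftK.
Qed.

Lemma ae_dominated mu nu (P : BD -> Prop) : mu `<< nu ->
  {ae nu, forall gamma, P gamma} -> {ae mu, forall gamma, P gamma}.
Proof.
move=> /null_content_dominatesP dom [A [mA nuA PA]].
by exists A; split => //; exact: dom.
Qed.

Lemma trig_indep_dominated (k : nat) (x : 'I_k -> G) mu nu :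
  mu `<< nu -> trig_indep x mu -> trig_indep x nu.
Proof. by move=> dom indep a a0; apply: indep; exact: ae_dominated a0. Qed.

End Independence.

Lemma cvg_EFin_real (R : realType) (f : nat -> R) (l : R) :
  f @ \oo --> l -> (fun n => (f n)%:E) @ \oo --> l%:E.
Proof. by move=> fl; apply: cvg_EFin => //; exact: nearW. Qed.

Theorem theorem6p2 (R : realType) (G : topologicalZmodType)
  (lcG : locally_compact [set: G]) (hG : hausdorff_space G)
  (k : nat) (k_gt0 : (0 < k)%N) (x : 'I_k -> G)
  (x_inj : injective x) (x_neq0 : forall i, x i != 0)
  (mu0 : {finite_measure set borel_dual R G -> \bar R})
  (mu : nat -> {finite_measure set borel_dual R G -> \bar R})
  (Mmu0 : class_M mu0) (Mmu : forall n, class_M (mu n))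
  (mu_cvg : wstar_cvg mu mu0) :
  (forall p : R, 0 < p ->
     d_p mu0 p (range x) = 0%E \/
       Lp_subspace_of_dim mu0 p (trig_poly (range x)) k ->
     (fun n => d_p (mu n) p (range x)) @ \oo --> d_p mu0 p (range x)) /\
  (forall p : R, 1 < p ->
     (forall n, mu0 `<< mu n) ->
     Lp_subspace_of_dim mu0 p (trig_poly (range x `|` [set 0])) k.+1 ->
     (fun n => d_p2 (mu n) mu0 p (range x)) @ \oo --> d_p mu0 p (range x) /\
     (fun n => Lp_dist mu0 p (metric_projection mu0 p (range x))
                             (metric_projection (mu n) p (range x)))
       @ \oo --> 0%E).
Proof.
split=> [p p_gt0 hyp|p p_gt1 dom dim].
  rewrite (d_p_least_err x p_gt0) (funext (fun n => d_p_least_err x p_gt0 (mu n))).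
  apply: cvg_EFin_real; case: hyp => [|/trig_indep_of_dim indep].
    by rewrite (d_p_least_err x p_gt0) => -[b0]; exact: least_err_cvg_zero.
  exact: least_err_cvg_indep.
have p_gt0 : 0 < p by exact: lt_trans p_gt1.
have indep : trig_indep x mu0.
  apply: trig_indep_with_zero; apply: (@trig_indep_of_dim _ _ _ _ _ p).
  by rewrite range_with_zero.
have [a0 [a0m mphi0 phi0E]] := metric_projection_trig p_gt0 indep.
have /choice[a aP] := fun n =>
  metric_projection_trig p_gt0 (trig_indep_dominated (dom n) indep).
have a_cvg : a @ \oo --> a0.
  by apply: (minimizers_cvg p_gt0 p_gt1 indep mu_cvg) => // n; case: (aP n).
have phiE n : {ae mu0, forall gamma : borel_dual R G,
    metric_projection (mu n) p (range x) gamma = trig x (a n) gamma}.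
  by apply: ae_dominated (dom n) _; case: (aP n).
have mphi n : cmeasurable (metric_projection (mu n) p (range x)).
  by case: (aP n).
have mt := trig_cmeasurable x.
have mc := @cst_cmeasurable R G.
split.
  rewrite (d_p_least_err x p_gt0).
  have d2E n : d_p2 (mu n) mu0 p (range x) = (err x p mu0 1 (a n))%:E.
    rewrite /d_p2 -(Lp_dist_err x p_gt0).
    by apply: ae_eq_Lp_dist; [..|exact: aeW|exact: phiE].
  rewrite (funext d2E); apply: cvg_EFin_real; apply/cvgrPdist_lt => e e0.
  near=> n; rewrite -a0m distrC; near: n.
  exact: (a_cvg _ (err_near0 x p_gt0 mu0 1 a0 e0)).
have dE n : Lp_dist mu0 p (metric_projection mu0 p (range x))
    (metric_projection (mu n) p (range x)) = (err x p mu0 0 (a n - a0))%:E.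
  rewrite -(Lp_dist_trig x p_gt0).
  by apply: ae_eq_Lp_dist; [..|exact: phi0E|exact: phiE].
rewrite (funext dE); apply: cvg_EFin_real; apply/cvgrPdist_lt => e e0.
near=> n; rewrite sub0r normrN ger0_norm ?err_ge0//; near: n.
exact: (a_cvg _ (err0B_near x p_gt0 mu0 a0 e0)).
Unshelve. all: by end_near. Qed.
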